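(* Let $\beta>0$ and $c>0$ be fixed. There exists a constant $\tilde\delta\in(0,1)$, independent of $n$, such that, for $G$ drawn from $\mu_n$, the following hold with $\mu_n$-probability tending to $1$ as $n\to\infty$: (a) $e_{U,U^c}(G)\ge(1-\tilde\delta)\,c\,|U|\log n$ for all $U\subseteq V$ with $|U|\le n/2$; and (b) the expansion $\phi$ and the conductance $\Phi$ of $G$ satisfy $$(1-\tilde\delta)\,c\log n\ \le\ \phi\ \le\ c\log n,\qquad (1-\tilde\delta)\ \le\ \Phi\ \le\ 1 .$$
   Context: For each sufficiently large $n$, let $E=E_n=\lfloor \tfrac12 c\,n\log n\rfloor$ (so that the mean degree $2E/n$ is $c\log n$ up to rounding). Let $\mu_n$ be the probability measure on simple labelled graphs $G$ with vertex set $V=\{1,\dots,n\}$ and exactly $E$ edges given by $\mu_n(G)=\frac1Z\exp\big(-\beta\sum_{i=1}^n d_i^2\big)$, where $d_i$ is the degree of vertex $i$ in $G$ and $Z$ is the normalizing constant. For $U\subseteq V$, $e_{U,U^c}=e_{U,U^c}(G)$ denotes the number of edges of $G$ with one endpoint in $U$ and the other in $U^c=V\setminus U$, and $\mathrm{Vol}(U)=\sum_{i\in U}d_i$. The expansion (isoperimetric constant) of $G$ is $$\phi=\inf_{\emptyset\ne U\subset V,\ |U|\le n/2}\frac{e_{U,U^c}}{|U|},$$ and the conductance of $G$ is $$\Phi=\inf_{U\subset V,\ 0<\mathrm{Vol}(U)\le E}\frac{e_{U,U^c}}{\mathrm{Vol}(U)}.$$ *)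

(* Defs.v *)
From HB Require Import structures.
From mathcomp Require Import all_boot all_order all_algebra.
From mathcomp Require Import all_classical all_reals all_analysis.

Set Implicit Arguments.
Unset Strict Implicit.
Unset Printing Implicit Defensive.

Import Order.TTheory GRing.Theory Num.Theory.
Import numFieldNormedType.Exports.

Local Open Scope ring_scope.

(* A graph on the vertex set 'I_n is given by its set of edges, an edge being a
   two-element set of vertices; [simple_graphs] imposes the cardinality. *)
Definition graph (n : nat) := {set {set 'I_n}}.

Definition simple_graphs (n m : nat) : {set graph n} :=
  [set G : graph n | [forall e in G, #|e| == 2%N] && (#|G| == m)]%SET.

Definition deg (n : nat) (G : graph n) (i : 'I_n) : nat :=
  #|[set e in G | i \in e]%SET|.

Definition edge_cut (n : nat) (G : graph n) (U : {set 'I_n}) : nat :=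
  #|[set e in G | [exists u in U, exists v in ~: U, e == [set u; v]]]%SET|.

Definition vol (n : nat) (G : graph n) (U : {set 'I_n}) : nat :=
  (\sum_(i in U) deg G i)%N.

(* [inf] is the real-valued infimum, by convention 0 on the empty set.  The
   index set of [expansion] is nonempty as soon as 2 <= n, and that of
   [conductance] as soon as the simple graph [G] has an edge, since an endpoint
   of an edge has degree between 1 and #|G|. *)
Definition expansion (R : realType) (n : nat) (G : graph n) : R :=
  inf [set (edge_cut G U)%:R / #|U|%:R
      | U in [set U : {set 'I_n} | U != finset.set0 /\ (2 * #|U| <= n)%N]]%classic.

Definition conductance (R : realType) (n : nat) (G : graph n) : R :=
  inf [set (edge_cut G U)%:R / (vol G U)%:R
      | U in [set U : {set 'I_n} | (0 < vol G U <= #|G|)%N]]%classic.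

Definition gibbs_weight (R : realType) (beta : R) (n : nat) (G : graph n) : R :=
  expR (- beta * \sum_(i < n) (deg G i)%:R ^+ 2).

Definition partition_function (R : realType) (beta : R) (n m : nat) : R :=
  \sum_(G in simple_graphs n m) gibbs_weight beta G.

(* The probability of the event [A].  When there is no simple graph with [n]
   vertices and [m] edges this is 0 / 0 = 0; for [m = num_edges c n] this
   happens for finitely many [n] only. *)
Definition gibbs_prob (R : realType) (beta : R) (n m : nat)
    (A : set (graph n)) : R :=
  (\sum_(G in simple_graphs n m | G \in A) gibbs_weight beta G)
    / partition_function beta n m.

(* [Num.truncn] is the floor here, its argument being nonnegative for 0 < c. *)
Definition num_edges (R : realType) (c : R) (n : nat) : nat :=
  Num.truncn (c * n%:R * ln n%:R / 2).

(* Main.v *)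
(* Write m for the integer part of c ln n / 23; two switching arguments bound
   the Gibbs mass of bad graphs.

   Degrees.  If d_x >= d_v + 3m, move an edge xy to vy for a neighbour y of x
   which is not a neighbour of v.  There are at least as many such moves as
   there are ways to undo one, and each move multiplies the weight by at least
   e^(2 beta m), so that m successive moves give
   P(d_x >= d_v + 3m) <= e^(-2 beta m^2), which beats the n^2 pairs (v, x).
   Since the mean degree is about 23m, all degrees lie in [19m, 27m].

   Cuts.  Let |U| = u <= n/2 and suppose that fewer than 3mu edges cross U.
   Replacing edges ab inside U and xy outside U by ax and by preserves all
   degrees, hence the weight, and adds 2 to the cut.  There are at least
   36 m^2 u n choices and at most (3mu)^2 ways to undo one, so each switching
   gains a factor 4n/u, and mu of them show that fewer than mu edges cross U
   with probability at most (u/4n)^(mu).  As 'C(n, u) (u/n)^u <= e^u, the union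
   bound over all U is a geometric series of ratio e 4^(-m), which tends to 0. *)

Require Import Defs.
From mathcomp Require Import all_boot all_order all_algebra.
From mathcomp Require Import all_classical all_reals all_analysis.
From mathcomp Require Import zify ring lra.
Import Order.TTheory GRing.Theory Num.Theory.
Import numFieldNormedType.Exports.
Import fintype boot.finset.

Set Implicit Arguments.
Unset Strict Implicit.
Unset Printing Implicit Defensive.

Local Open Scope set_scope.
Local Open Scope ring_scope.

(** * Weighted double counting of switchings *)

(* Each G in A spreads its weight evenly over its moves t in [P G]; by injectivity
   of [f t], a graph H of A' receives at most one share for each t in [Q H]. *)
Lemma switching_bound (R : realFieldType) (Om T : finType) (A A' : {set Om})
    (P Q : Om -> {set T}) (f : T -> Om -> Om) (w : Om -> R) (alpha : R) :
  (forall G, 0 <= w G) -> 0 <= alpha ->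
  (forall G t, G \in A -> t \in P G -> f t G \in A' /\ t \in Q (f t G)) ->
  (forall t G H, G \in A -> H \in A -> t \in P G -> t \in P H ->
     f t G = f t H -> G = H) ->
  (forall G, G \in A -> (0 < #|P G|)%N) ->
  (forall G t, G \in A -> t \in P G ->
     w G * #|Q (f t G)|%:R <= alpha * w (f t G) * #|P G|%:R) ->
  \sum_(G in A) w G <= alpha * \sum_(G in A') w G.
Proof.
move=> w0 a0 fA finj P0 wPQ.
(* Every share that [H] receives is at most [h H]. If [Q H] is empty, division by zero makes [h H]
   equal to 0, in agreement with [H] receiving no share. *)
pose h H := alpha * w H / #|Q H|%:R.
have h0 H : 0 <= h H by rewrite /h divr_ge0 ?mulr_ge0.
have -> : \sum_(G in A) w G = \sum_(G in A) \sum_(t in P G) w G / #|P G|%:R.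
  apply: eq_bigr => G GA; rewrite sumr_const -[RHS]mulr_natr divfK //.
  by rewrite pnatr_eq0 -lt0n P0.
apply: (@le_trans _ _ (\sum_(G in A) \sum_(t in P G) h (f t G))).
  apply: ler_sum => G GA; apply: ler_sum => t tP.
  have [_ tQ] := fA _ _ GA tP.
  have Q0 : 0 < #|Q (f t G)|%:R :> R by rewrite ltr0n; apply/card_gt0P; exists t.
  have P0' : 0 < #|P G|%:R :> R by rewrite ltr0n P0.
  by rewrite /h ler_pdivlMr // mulrAC ler_pdivrMr // wPQ.
rewrite (exchange_big_dep predT) //=.
apply: (@le_trans _ _ (\sum_t \sum_(H in A' | t \in Q H) h H)).
  apply: ler_sum => t _.
  have inj : {in [pred G | (G \in A) && (t \in P G)] &, injective (f t)}.
    by move=> G H; rewrite !inE => /andP[GA tG] /andP[HA tH]; exact: finj.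
  rewrite -(big_imset _ inj (h := f t)) /= [leRHS]big_mkcond [leLHS]big_mkcond /=.
  apply: ler_sum => H _; case: ifP => [/imsetP[G]|_]; last by case: ifP.
  by rewrite inE => /andP[GA tP] ->; have [-> ->] := fA _ _ GA tP.
rewrite -(exchange_big_dep predT) //= mulr_sumr; apply: ler_sum => H _.
rewrite sumr_const -[leLHS]mulr_natr /h.
have [->|Q0] := eqVneq #|Q H| 0%N; first by rewrite mulr0 mulr_ge0.
by rewrite divfK // pnatr_eq0.
Qed.

(** * Exchange of edge sets *)

Definition switch (T : finType) (C D G : {set T}) : {set T} := C :|: (G :\: D).

Lemma switchK (T : finType) (C D G : {set T}) :
  D \subset G -> [disjoint C & G] -> switch D C (switch C D G) = G.
Proof.
move=> /subsetP DG CG; apply/setP => e; rewrite !inE.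
have := DG e; case: (e \in D) => //= [/(_ isT) ->//|_].
by case eC: (e \in C) => //=; rewrite (disjointFr CG).
Qed.

(** One identity tracks every effect of a switching: [p] will be membership of a vertex for degrees,
    crossing of a set for cuts, and [predT] for the number of edges. The additive form avoids
    truncated subtraction. *)
Lemma card_switch (T : finType) (p : pred T) (C D G : {set T}) :
  D \subset G -> [disjoint C & G] ->
  (#|[set e in switch C D G | p e]| + #|[set e in D | p e]| =
   #|[set e in C | p e]| + #|[set e in G | p e]|)%N.
Proof.
move=> DG CG.
have -> : [set e in switch C D G | p e] =
  [set e in C | p e] :|: ([set e in G | p e] :\: [set e in D | p e]).
  apply/setP => e; rewrite !inE; case: (p e); rewrite ?andbF ?andbT //.
have sub : [set e in D | p e] \subset [set e in G | p e].
  by apply/subsetP => e; rewrite !inE => /andP[/(subsetP DG) -> ->].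
rewrite cardsU (_ : _ :&: _ = set0) ?cards0; last first.
  apply/setP => e; rewrite !inE; apply/negbTE/negP => /andP[/andP[eC _]].
  by rewrite (disjointFr CG eC) /= andbF.
rewrite cardsD (setIidPr sub) subn0 -addnA subnK //.
exact: subset_leq_card.
Qed.

(** * Adjacency, cuts and volumes *)

Definition adj (n : nat) (G : graph n) (a b : 'I_n) : bool := [set a; b] \in G.

Lemma adj_sym (n : nat) (G : graph n) (a b : 'I_n) : adj G a b = adj G b a.
Proof. by rewrite /adj setUC. Qed.

Lemma simple_card (n m : nat) (G : graph n) : G \in simple_graphs n m -> #|G| = m.
Proof. by rewrite inE => /andP[_ /eqP]. Qed.

Lemma simple_edge (n m : nat) (G : graph n) e :
  G \in simple_graphs n m -> e \in G -> exists a b, a != b /\ e = [set a; b].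
Proof.
rewrite inE => /andP[/forall_inP H _] /H /cards2P [a [b [ab ->]]].
by exists a, b.
Qed.

Lemma adj_neq (n m : nat) (G : graph n) (a b : 'I_n) :
  G \in simple_graphs n m -> adj G a b -> a != b.
Proof.
rewrite inE => /andP[/forall_inP H _] /H; rewrite cards2.
by case: (a != b).
Qed.



Lemma deg_adj (n m : nat) (G : graph n) i :
  G \in simple_graphs n m -> deg G i = (\sum_j adj G i j)%N.
Proof.
move=> sG; rewrite /deg -sum1_card.
have inj : {in [set j | adj G i j] &, injective (fun j => [set i; j])}.
  move=> a b; rewrite !inE => /(adj_neq sG) ia /(adj_neq sG) ib /setP /(_ a).
  by rewrite !inE eqxx orbT eq_sym (negbTE ia) => /esym/eqP.
rewrite (_ : [set e in G | i \in e] = [set [set i; j] | j in [set j | adj G i j]]).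
  rewrite big_imset //= big_mkcond /=.
  by apply: eq_bigr => j _; rewrite inE; case: (adj G i j).
apply/setP => e; rewrite inE; apply/andP/imsetP => [[eG]|[j]]; last first.
  by rewrite inE => ij ->; split; rewrite ?inE ?eqxx.
have [a [b [ab e_eq]]] := simple_edge sG eG; subst e.
rewrite !inE => /orP[]/eqP ->; first by exists b; rewrite ?inE.
by exists a; rewrite ?inE /adj setUC.
Qed.

(** Edges are counted with orientation, so that each edge of a simple graph inside [A] counts twice
    in [darts G A A]. *)
Definition darts (n : nat) (G : graph n) (A B : {set 'I_n}) : nat :=
  (\sum_(a in A) \sum_(b in B) adj G a b)%N.

Lemma darts_sym (n : nat) (G : graph n) (A B : {set 'I_n}) :
  darts G A B = darts G B A.
Proof.
rewrite /darts exchange_big; apply: eq_bigr => b _.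
by apply: eq_bigr => a _; rewrite adj_sym.
Qed.

(** A crossing edge has exactly one orientation leaving [U], so forgetting orientations is injective
    here. *)
Lemma edge_cut_darts (n : nat) (G : graph n) (U : {set 'I_n}) :
  edge_cut G U = darts G U (~: U).
Proof.
rewrite /edge_cut /darts pair_big /= -sum1_card.
pose D := [set p : 'I_n * 'I_n | (p.1 \in U) && (p.2 \in ~: U) && adj G p.1 p.2].
have inj : {in D &, injective (fun p => [set p.1; p.2])}.
  move=> [a b] [x y]; rewrite !inE /= => /andP[/andP[aU bU] _].
  move=> /andP[/andP[xU yU] _] /setP E.
  have neq (v w : 'I_n) : v \in U -> w \notin U -> (v == w) = false.
    by move=> vU; apply: contraNF => /eqP <-.
  have := E a; rewrite !inE eqxx (neq a y) // orbF /= => /esym/eqP ->.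
  by have := E b; rewrite !inE eqxx orbT ![b == _]eq_sym (neq x b) //= => /esym/eqP ->.
rewrite (_ : [set e in G | _] = [set [set p.1; p.2] | p in D]).
  rewrite big_imset //= [LHS]big_mkcond [RHS]big_mkcond /=.
  apply: eq_bigr => p _; rewrite !inE.
  by case: (p.1 \in U); case: (p.2 \in U); case: (adj _ _ _).
apply/setP => e; rewrite inE; apply/andP/imsetP => [[eG]|[[a b]]].
  move=> /exists_inP[a aU /exists_inP[b bU /eqP e_eq]]; subst e.
  by exists (a, b); rewrite // inE aU bU.
rewrite inE => /andP[/andP[/= aU bU] ab] ->; split=> //.
by apply/exists_inP; exists a => //; apply/exists_inP; exists b.
Qed.

Lemma edge_cutC (n : nat) (G : graph n) (U : {set 'I_n}) :
  edge_cut G (~: U) = edge_cut G U.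
Proof. by rewrite !edge_cut_darts setCK darts_sym. Qed.

Lemma vol_darts (n m : nat) (G : graph n) (U : {set 'I_n}) :
  G \in simple_graphs n m -> vol G U = (darts G U U + edge_cut G U)%N.
Proof.
move=> sG; rewrite edge_cut_darts /darts -big_split /=.
apply: eq_bigr => a _; rewrite (deg_adj _ sG) (bigID (mem U)) /=.
by congr addn; apply: eq_bigl => b; rewrite inE.
Qed.

Lemma edge_cut1 (n m : nat) (G : graph n) (i : 'I_n) :
  G \in simple_graphs n m -> edge_cut G [set i] = deg G i.
Proof.
move=> sG; have := vol_darts [set i] sG.
rewrite /vol /darts !big_set1 (_ : adj G i i = false) //.
by apply/negP => /(adj_neq sG); rewrite eqxx.
Qed.

Lemma handshake (n m : nat) (G : graph n) :
  G \in simple_graphs n m -> (\sum_i deg G i = 2 * m)%N.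
Proof.
move=> sG; rewrite -{1}(simple_card sG) -sum1_card big_distrr /=.
have -> : (\sum_i deg G i = \sum_i \sum_(e in G) (i \in e))%N.
  apply: eq_bigr => i _; rewrite /deg -sum1_card big_mkcond [RHS]big_mkcond /=.
  by apply: eq_bigr => e _; rewrite inE; case: (e \in G); case: (i \in e).
rewrite exchange_big; apply: eq_bigr => e eG /=.
have [a [b [ab ->]]] := simple_edge sG eG.
transitivity #|[set a; b]|; last by rewrite cards2 ab.
rewrite -sum1_card [RHS]big_mkcond /=.
by apply: eq_bigr => i _; case: (i \in _).
Qed.

Lemma vol_setC (n m : nat) (G : graph n) (U : {set 'I_n}) :
  G \in simple_graphs n m -> (vol G U + vol G (~: U) = 2 * m)%N.
Proof.
move=> sG; rewrite -(handshake sG) (bigID (mem U)) /=; congr addn.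
by apply: eq_bigl => i; rewrite inE.
Qed.

(** * Exchanges within simple graphs *)

Lemma card_filter1 (T : finType) (p : pred T) (e : T) :
  #|[set f in [set e] | p f]| = p e.
Proof.
rewrite -sum1_card (eq_bigl (fun f => (f \in [set e]) && p f)); last first.
  by move=> f; rewrite inE.
by rewrite big_mkcondr big_set1; case: (p e).
Qed.

Lemma card_filter2 (T : finType) (p : pred T) (e f : T) :
  e != f -> #|[set g in [set e; f] | p g]| = (p e + p f)%N.
Proof.
move=> ef; rewrite -sum1_card (eq_bigl (fun g => (g \in [set e; f]) && p g)).
  by rewrite big_mkcondr big_setU1 ?inE // big_set1; case: (p e); case: (p f).
by move=> g; rewrite inE.
Qed.

Lemma switch_simple (n m : nat) (C D G : graph n) :
  G \in simple_graphs n m -> D \subset G -> [disjoint C & G] ->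
  #|C| = #|D| -> (forall e, e \in C -> #|e| == 2%N) ->
  switch C D G \in simple_graphs n m.
Proof.
move=> sG DG CG CD C2; move: sG; rewrite !inE => /andP[/forall_inP G2 /eqP Gm].
apply/andP; split.
  apply/forall_inP => e; rewrite !inE => /orP[/C2//|/andP[_ /G2//]].
have := card_switch predT DG CG; rewrite -Gm !setIdE !setIT CD addnC.
by move/addnI ->.
Qed.

Lemma set2_eq (n : nat) (a b c d : 'I_n) :
  ([set a; b] == [set c; d]) = (a == c) && (b == d) || (a == d) && (b == c).
Proof.
apply/eqP/idP => [E|/orP[]/andP[/eqP-> /eqP->] //]; last by rewrite setUC.
move/setP: (E) => /(_ a); move/setP: (E) => /(_ b).
move/setP: (E) => /(_ c); move/setP: (E) => /(_ d).
rewrite !inE !eqxx !orbT /= ![c == _]eq_sym ![d == _]eq_sym.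
by do 4 case: eqVneq => //= _.
Qed.

(** * Gibbs weights and chains of switchings *)

Lemma sum_deg_sqE (R : realType) (n : nat) (G : graph n) :
  \sum_(i < n) (deg G i)%:R ^+ 2 = (\sum_(i < n) deg G i ^ 2)%N%:R :> R.
Proof. by rewrite natr_sum; apply: eq_bigr => i _; rewrite natrX. Qed.

Lemma gibbs_weight_ge0 (R : realType) (beta : R) (n : nat) (G : graph n) :
  0 <= gibbs_weight beta G.
Proof. exact: expR_ge0. Qed.

Lemma gibbs_weight_le (R : realType) (beta : R) (n k : nat) (G H : graph n) :
  0 <= beta -> (\sum_i deg H i ^ 2 + k <= \sum_i deg G i ^ 2)%N ->
  gibbs_weight beta G <= expR (- (beta * k%:R)) * gibbs_weight beta H.
Proof.
move=> b0 le; rewrite /gibbs_weight -expRD ler_expR !sum_deg_sqE.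
move: le; rewrite -(ler_nat R) natrD => le.
by rewrite !mulNr -opprD lerN2 -mulrDr ler_wpM2l // addrC.
Qed.

Lemma geometric_chain (R : realDomainType) (u : nat -> R) (alpha : R) (N : nat) :
  0 <= alpha -> (forall j, (j < N)%N -> u j <= alpha * u j.+1) ->
  u 0%N <= alpha ^+ N * u N.
Proof.
move=> a0; elim: N => [|N IH] H; first by rewrite expr0 mul1r.
apply: le_trans (IH _) _; first by move=> j jN; apply: H; apply: ltnW.
by rewrite exprSr -mulrA ler_wpM2l ?exprn_ge0 ?H.
Qed.

(** * Degrees: moving edges from x to v *)

(** These y are the admissible moves of xy to vy: excluding neighbours of v prevents a double edge,
    and excluding v itself prevents a loop. *)
Definition private_nbrs (n : nat) (G : graph n) (x v : 'I_n) : {set 'I_n} :=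
  [set y | [&& adj G x y, ~~ adj G v y & y != v]].

(** Common neighbours cancel, and so does a possible edge xv, which contributes to both degrees but
    to neither private set. *)
Lemma card_private_nbrs (n m : nat) (G : graph n) (x v : 'I_n) :
  G \in simple_graphs n m ->
  (#|private_nbrs G x v| + deg G v = #|private_nbrs G v x| + deg G x)%N.
Proof.
move=> sG; have [->//|xv] := eqVneq x v.
have cardE (a b : 'I_n) : #|private_nbrs G a b| =
    (\sum_y [&& adj G a y, ~~ adj G b y & y != b])%N.
  rewrite -sum1_card big_mkcond /=; apply: eq_bigr => y _.
  by rewrite inE; case: [&& _, _ & _].
rewrite !cardE !(deg_adj _ sG) -!big_split /=.
have irr y : adj G y y = false by apply/negP => /(adj_neq sG); rewrite eqxx.
rewrite (bigD1 v) // (bigD1 x) //= [RHS](bigD1 v) // [in RHS](bigD1 x) //=.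
rewrite !eqxx !irr (adj_sym G v x) !andbF /=.
rewrite !addn0 !add0n; congr addn.
apply: eq_bigr => y /andP[yv yx]; rewrite yv yx.
by case: (adj G x y); case: (adj G v y).
Qed.

(** The vertex y lies on both the removed and the added edge, so only the degrees of x and v
    change. *)
Lemma rewire_facts (n m : nat) (G : graph n) (x v y : 'I_n) :
  G \in simple_graphs n m -> x != v -> y \in private_nbrs G x v ->
  let C : graph n := [set [set v; y]] in let D : graph n := [set [set x; y]] in
  [/\ D \subset G, [disjoint C & G], switch C D G \in simple_graphs n m &
      forall i, (deg (switch C D G) i + (i == x) = deg G i + (i == v))%N].
Proof.
move=> sG xv; rewrite inE => /and3P[xy vy yv] C D.
have DG : D \subset G by rewrite sub1set.
have CG : [disjoint C & G] by rewrite disjoints1.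
have yx : y != x by rewrite eq_sym (adj_neq sG).
split=> // [|i].
  apply: switch_simple => //; first by rewrite !cards1.
  by move=> e; rewrite inE => /eqP ->; rewrite cards2 [v == y]eq_sym yv.
have := card_switch (fun e : {set 'I_n} => i \in e) DG CG.
rewrite !card_filter1 -/(deg _ _) -/(deg _ _) !inE.
case: (eqVneq i y) => [->|iy]; last by rewrite !orbF addnC [in RHS]addnC addnC.
by rewrite (negbTE yx) (negbTE yv) !orbT addnC !addn0 => /addnI.
Qed.

Definition spread (n E : nat) (v x : 'I_n) (g : nat) : {set graph n} :=
  [set G in simple_graphs n E | (deg G v + g <= deg G x)%N].

(* The move lowers the sum of the squared degrees by 2 (d_x - d_v - 1). *)
Lemma rewire_step (R : realType) (beta : R) (n m E j : nat) (v x : 'I_n) :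
  0 <= beta -> x != v -> (j < m)%N ->
  \sum_(G in spread E v x (3 * m - 2 * j)) gibbs_weight beta G <=
    expR (- (beta * (2 * m)%:R)) *
    \sum_(G in spread E v x (3 * m - 2 * j.+1)) gibbs_weight beta G.
Proof.
move=> b0 xv jm.
pose f (y : 'I_n) (G : graph n) : graph n := switch [set [set v; y]] [set [set x; y]] G.
have vx : (v == x) = false by rewrite eq_sym (negbTE xv).
have degs G y : G \in simple_graphs n E -> y \in private_nbrs G x v ->
    [/\ f y G \in simple_graphs n E, deg (f y G) v = (deg G v).+1,
        (deg (f y G) x).+1 = deg G x &
        forall i, i != v -> i != x -> deg (f y G) i = deg G i].
  move=> sG yP; have [_ _ sf H] := rewire_facts sG xv yP; split=> //.
  - by have := H v; rewrite eqxx vx -/(f y G); lia.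
  - by have := H x; rewrite eqxx (negbTE xv) -/(f y G); lia.
  - by move=> i iv ix; have := H i; rewrite (negbTE iv) (negbTE ix) !addn0.
have inA G k : G \in spread E v x k ->
    G \in simple_graphs n E /\ (deg G v + k <= deg G x)%N.
  by rewrite inE => /andP[].
apply: (switching_bound (P := fun G => private_nbrs G x v) (Q := fun G => private_nbrs G v x) (f := f)).
- by move=> G; exact: gibbs_weight_ge0.
- exact: expR_ge0.
- move=> G y /inA[sG dG] yP; have [sf dv dx _] := degs _ _ sG yP.
  rewrite inE sf /=; split; first by rewrite dv; lia.
  move: yP; rewrite !inE => /and3P[xy vy yv].
  have yx : y != x by rewrite eq_sym (adj_neq sG).
  by rewrite yx /adj /f /switch !inE !eqxx /= orbF set2_eq (negbTE xv) eq_sym (negbTE yx).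
- move=> y G H /inA[sG _] /inA[sH _] yP yP' fGH.
  have [D1 C1 _ _] := rewire_facts sG xv yP.
  have [D2 C2 _ _] := rewire_facts sH xv yP'.
  by rewrite -(switchK D1 C1) -/(f y G) fGH switchK.
- by move=> G /inA[sG dG]; have := card_private_nbrs x v sG; lia.
- move=> G y /inA[sG dG] yP; have [sf dv dx di] := degs _ _ sG yP.
  (* There are at most as many moves back as forward: after the move the degree of x still exceeds
     that of v, and x has gained no private neighbour. *)
  have PQ : (#|private_nbrs (f y G) v x| <= #|private_nbrs G x v|)%N.
    have := card_private_nbrs x v sf.
    suff : (#|private_nbrs (f y G) x v| <= #|private_nbrs G x v|)%N by lia.
    apply/subset_leq_card/subsetP => z; move: yP; rewrite !inE => /and3P[xy vy yv].
    have yx : y != x by rewrite eq_sym (adj_neq sG).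
    rewrite /adj /f /switch !inE !set2_eq (negbTE xv) vx [x == y]eq_sym (negbTE yx).
    rewrite [v == y]eq_sym (negbTE yv) !eqxx !orbF /=.
    by case: (z == y) => //=; case: (z \in _) => //=; case: ([set v; z] \in G); rewrite ?andbF.
  apply: ler_pM; rewrite ?gibbs_weight_ge0 ?ler0n ?ler_nat //.
  apply: gibbs_weight_le => //.
  rewrite (bigD1 v) // (bigD1 x) //= [leqRHS](bigD1 v) // [in leqRHS](bigD1 x) //=.
  rewrite (eq_bigr (fun i => deg G i ^ 2)%N); last first.
    by move=> i /andP[iv ix]; rewrite di.
  rewrite dv -dx -!mulnn; set S := (\sum_(i | _) _)%N; nia.
Qed.

(** Each of the m moves narrows the guaranteed gap by 2, from 3m down to m. Before every move the
    gap is thus at least m + 2, and the sum of squared degrees drops by more than 2m. *)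
Lemma spread_bound (R : realType) (beta : R) (n m E : nat) (v x : 'I_n) :
  0 <= beta -> x != v ->
  \sum_(G in spread E v x (3 * m)) gibbs_weight beta G
    <= expR (- (beta * (2 * m)%:R)) ^+ m * partition_function beta n E.
Proof.
move=> b0 xv.
pose u k := \sum_(G in spread E v x (3 * m - 2 * k)) gibbs_weight beta G.
have := @geometric_chain _ u _ m (expR_ge0 _) (fun j jm => rewire_step E b0 xv jm).
rewrite /u muln0 subn0 => /le_trans; apply.
rewrite ler_wpM2l ?exprn_ge0 ?expR_ge0 // /partition_function.
rewrite [leLHS]big_mkcond [leRHS]big_mkcond /=; apply: ler_sum => G _.
rewrite inE; case: (G \in simple_graphs _ _) => //=.
by case: ifP => // _; exact: gibbs_weight_ge0.
Qed.

(** * Cuts: counting switchings across U *)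

Lemma card_quad (I : finType) (p : pred ((I * I) * (I * I))) :
  #|[set t | p t]| = (\sum_a \sum_b \sum_x \sum_y p ((a, b), (x, y)))%N.
Proof.
rewrite -sum1_card big_mkcond /=.
under [RHS]eq_bigr do under eq_bigr do rewrite pair_big /=.
rewrite !pair_big /=; apply: eq_bigr => [[[a b] [x y]]] _ /=.
by rewrite inE; case: (p _).
Qed.

Lemma sum_quad_mul (I : finType) (f g : I -> I -> nat) :
  (\sum_a \sum_b \sum_x \sum_y f a b * g x y =
   (\sum_a \sum_b f a b) * (\sum_x \sum_y g x y))%N.
Proof.
rewrite big_distrl; apply: eq_bigr => a _; rewrite big_distrl; apply: eq_bigr => b _ /=.
by rewrite big_distrr; apply: eq_bigr => x _; rewrite big_distrr.
Qed.

(** With [h] the adjacency, these are weighted paths b, a, x, y grouped by their middle pair ax; the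
    inner sums then become degrees. *)
Lemma sum_quad_path (I : finType) (c h : I -> I -> nat) :
  (\sum_a \sum_b \sum_x \sum_y c a x * (h a b * h x y) =
   \sum_a \sum_x c a x * ((\sum_b h a b) * (\sum_y h x y)))%N.
Proof.
apply: eq_bigr => a _; rewrite exchange_big; apply: eq_bigr => x _ /=.
rewrite big_distrl [RHS]big_distrr; apply: eq_bigr => b _ /=.
by rewrite big_distrr [RHS]big_distrr.
Qed.

Lemma dartsE (n : nat) (G : graph n) (A B : {set 'I_n}) :
  darts G A B = (\sum_a \sum_b [&& a \in A, b \in B & adj G a b])%N.
Proof.
rewrite /darts big_mkcond; apply: eq_bigr => a _.
case: (a \in A) => /=; last by rewrite big1.
by rewrite big_mkcond; apply: eq_bigr => b _; case: (b \in B).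
Qed.

Lemma crosses_pair (n : nat) (U : {set 'I_n}) (a b : 'I_n) :
  [exists u in U, exists v in ~: U, [set a; b] == [set u; v]] =
    (a \in U) (+) (b \in U).
Proof.
apply/exists_inP/idP => [[u uU /exists_inP[v]]|].
  rewrite inE set2_eq => vU /orP[]/andP[/eqP-> /eqP->].
    by rewrite uU (negbTE vU).
  by rewrite uU (negbTE vU).
case aU: (a \in U) => /= bU.
  by exists a => //; apply/exists_inP; exists b; rewrite ?inE.
by exists b => //; apply/exists_inP; exists a; rewrite ?inE ?aU // setUC.
Qed.

(* A quadruple ((a, b), (x, y)) encodes the switching of ab and xy into ax and
   by; [inner_pairs] are the possible switchings across U, and [outer_pairs]
   contains those which may have produced G. *)
Definition inner_pairs (n : nat) (G : graph n) (U : {set 'I_n}) :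
    {set ('I_n * 'I_n) * ('I_n * 'I_n)} :=
  [set t | [&& t.1.1 \in U, t.1.2 \in U, t.2.1 \notin U, t.2.2 \notin U,
    adj G t.1.1 t.1.2, adj G t.2.1 t.2.2,
    ~~ adj G t.1.1 t.2.1 & ~~ adj G t.1.2 t.2.2]].

Definition outer_pairs (n : nat) (G : graph n) (U : {set 'I_n}) :
    {set ('I_n * 'I_n) * ('I_n * 'I_n)} :=
  [set t | [&& t.1.1 \in U, t.1.2 \in U, t.2.1 \notin U, t.2.2 \notin U,
    adj G t.1.1 t.2.1 & adj G t.1.2 t.2.2]].

Definition cross (n : nat) (t : ('I_n * 'I_n) * ('I_n * 'I_n)) (G : graph n) :
    graph n :=
  switch [set [set t.1.1; t.2.1]; [set t.1.2; t.2.2]]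
         [set [set t.1.1; t.1.2]; [set t.2.1; t.2.2]] G.

(** Regrouping (a, b), (x, y) as (a, x), (b, y) gives all ordered pairs of cut edges, the two edges
    being allowed to share vertices or coincide. *)
Lemma card_outer_pairs (n : nat) (G : graph n) (U : {set 'I_n}) :
  #|outer_pairs G U| = (edge_cut G U ^ 2)%N.
Proof.
rewrite card_quad /= edge_cut_darts dartsE -mulnn -sum_quad_mul.
apply: eq_bigr => a _; rewrite exchange_big; apply: eq_bigr => x _ /=.
apply: eq_bigr => b _; apply: eq_bigr => y _; rewrite !inE.
by case: (a \in U); case: (b \in U); case: (x \in U); case: (y \in U);
   case: (adj G a x); case: (adj G b y).
Qed.

(* A pair of directed edges ab, xy fails to be switchable only when ax or by is
   an edge of the cut, and then it is a path of length 3 through that edge. *)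
Lemma card_inner_pairs (n m Delta : nat) (G : graph n) (U : {set 'I_n}) :
  G \in simple_graphs n m -> (forall i, (deg G i <= Delta)%N) ->
  (darts G U U * darts G (~: U) (~: U) <=
   #|inner_pairs G U| + 2 * (edge_cut G U * Delta ^ 2))%N.
Proof.
move=> sG degD.
pose c a x : nat := [&& a \in U, x \in ~: U & adj G a x].
pose h a b : nat := adj G a b.
have path_le : (\sum_a \sum_b \sum_x \sum_y c a x * (h a b * h x y) <=
    edge_cut G U * Delta ^ 2)%N.
  rewrite sum_quad_path edge_cut_darts dartsE big_distrl /=.
  apply: leq_sum => a _; rewrite big_distrl /=; apply: leq_sum => x _.
  by rewrite leq_mul2l -mulnn leq_mul ?orbT // -(deg_adj _ sG).
(* Exchanging a with b and x with y carries paths through by to paths through ax. *)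
have path_sym : (\sum_a \sum_b \sum_x \sum_y c b y * (h a b * h x y) =
    \sum_a \sum_b \sum_x \sum_y c a x * (h a b * h x y))%N.
  rewrite exchange_big; apply: eq_bigr => b _; apply: eq_bigr => a _.
  rewrite exchange_big; apply: eq_bigr => y _; apply: eq_bigr => x _.
  by rewrite /h (adj_sym G a) (adj_sym G x).
rewrite mul2n -addnn; apply: leq_trans (leq_add (leqnn _) (leq_add path_le path_le)).
rewrite -{1}path_sym !dartsE -sum_quad_mul card_quad -!big_split /=.
apply: leq_sum => a _; rewrite -!big_split; apply: leq_sum => b _ /=.
rewrite -!big_split; apply: leq_sum => x _; rewrite -!big_split; apply: leq_sum => y _ /=.
rewrite /c /h !inE.
by case: (a \in U); case: (b \in U); case: (x \in U); case: (y \in U) => //=;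
   case: (adj G a b); case: (adj G x y); case: (adj G a x); case: (adj G b y).
Qed.

Lemma cross_facts (n m : nat) (G : graph n) (U : {set 'I_n})
    (t : ('I_n * 'I_n) * ('I_n * 'I_n)) :
  G \in simple_graphs n m -> t \in inner_pairs G U ->
  [/\ cross t G \in simple_graphs n m, deg (cross t G) =1 deg G,
      edge_cut (cross t G) U = (edge_cut G U + 2)%N &
      t \in outer_pairs (cross t G) U].
Proof.
case: t => [[a b] [x y]] sG; rewrite [_ \in inner_pairs _ _]inE /cross /=.
move=> /and5P[aU bU xU yU /and4P[ab xy ax yb]].
set C := [set [set a; x]; _]; set D := [set [set a; b]; _].
have neq v w : v \in U -> w \notin U -> (v == w) = false.
  by move=> vU; apply: contraNF => /eqP <-.
have ab' := adj_neq sG ab; have xy' := adj_neq sG xy.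
have CD : [set a; x] != [set b; y] :> {set 'I_n}.
  by rewrite set2_eq (negbTE ab') (neq a y).
have DD : [set a; b] != [set x; y] :> {set 'I_n}.
  by rewrite set2_eq (neq a x) // (neq a y).
have DG : D \subset G by apply/subsetP => e; rewrite !inE => /orP[]/eqP->.
have CG : [disjoint C & G].
  by rewrite disjoint_subset; apply/subsetP => e; rewrite !inE => /orP[]/eqP->.
split.
- apply: (switch_simple sG DG CG); first by rewrite !cards2 CD DD.
  by move=> e; rewrite !inE => /orP[]/eqP->; rewrite cards2 neq.
- move=> i; have := card_switch (fun e : {set 'I_n} => i \in e) DG CG.
  rewrite !card_filter2 // -/(deg _ _) -/(deg _ _) !inE.
  (* Each of a, b, x, y lies on exactly one added and one removed edge. *)
  have -> : (((i == a) || (i == x)) + ((i == b) || (i == y)) =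
      ((i == a) || (i == b)) + ((i == x) || (i == y)))%N.
    case: (eqVneq i a) => [->|_] /=.
      by rewrite (negbTE ab') !(neq a).
    case: (eqVneq i x) => [->|_] /=.
      by rewrite (negbTE xy') orbF addnC.
    by case: (eqVneq i b) => [->|_] //; rewrite (neq b y).
  by rewrite [LHS]addnC => /addnI.
- have := card_switch
    (fun e : {set 'I_n} => [exists u in U, exists v in ~: U, e == [set u; v]]) DG CG.
  rewrite !card_filter2 // !crosses_pair -/(edge_cut _ _) -/(edge_cut _ _).
  by rewrite aU bU (negbTE xU) (negbTE yU) /= !addn0 => ->; rewrite addnC.
- by rewrite !inE /= aU bU xU yU /adj /switch !inE !eqxx !orbT.
Qed.

Lemma crossK (n : nat) (G : graph n) (U : {set 'I_n})
    (t : ('I_n * 'I_n) * ('I_n * 'I_n)) :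
  t \in inner_pairs G U ->
  switch [set [set t.1.1; t.1.2]; [set t.2.1; t.2.2]]
         [set [set t.1.1; t.2.1]; [set t.1.2; t.2.2]] (cross t G) = G.
Proof.
rewrite inE => /and5P[aU bU xU yU /and4P[ab xy ax yb]]; apply: switchK.
  by apply/subsetP => e; rewrite !inE => /orP[]/eqP->.
by rewrite disjoint_subset; apply/subsetP => e; rewrite !inE => /orP[]/eqP->.
Qed.

(** * Sparse cuts in graphs with balanced degrees *)

Definition balanced (n E m : nat) : {set graph n} :=
  [set G in simple_graphs n E | [forall i, (19 * m <= deg G i <= 27 * m)%N]].

Definition sparse_cut (n E m : nat) (U : {set 'I_n}) (k : nat) : {set graph n} :=
  [set G in balanced n E m | (edge_cut G U < k)%N].

(** Write u = |U|. Subtracting the cut from the volumes leaves at least 19mu - 3mu = 16mu darts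
    inside U and 19m(n - u) - 3mu >= 8mn outside, hence 128 m^2 un pairs. At most 2 (3mu) (27m)^2 =
    4374 m^3 u of them fail, which is below 44 m^2 un because 100m <= n. *)
Lemma inner_pairs_ge (n E m : nat) (U : {set 'I_n}) (G : graph n) :
  (0 < m)%N -> (100 * m <= n)%N -> (2 * #|U| <= n)%N ->
  G \in sparse_cut E m U (3 * (m * #|U|)) ->
  (36 * (m ^ 2 * #|U| * n) <= #|inner_pairs G U|)%N.
Proof.
move=> m0 mn Un; rewrite !inE -andbA => /and3P[sG /forallP dG cutU].
have {}sG : G \in simple_graphs n E by rewrite inE.
have volge (A : {set 'I_n}) : (19 * m * #|A| <= vol G A)%N.
  rewrite /vol mulnC -sum_nat_const; apply: leq_sum => i _.
  by have /andP[] := dG i.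
have := card_inner_pairs U sG (fun i => proj2 (andP (dG i))).
have := volge U; have := volge (~: U); rewrite !(vol_darts _ sG) edge_cutC.
have := cardsC U; rewrite card_ord.
move: (darts _ _ _) (darts _ _ _) (edge_cut _ _) cutU (#|~: U|) #|inner_pairs _ _|.
move=> dU dC k kU c p cE hC hU hp.
have mcE : (m * #|U| + m * c = m * n)%N by rewrite -mulnDr cE.
have dU16 : (16 * (m * #|U|) <= dU)%N by rewrite -mulnA in hU; lia.
have mU : (2 * (m * #|U|) <= m * n)%N by rewrite mulnCA leq_mul2l Un orbT.
have dC8 : (8 * (m * n) <= dC)%N by rewrite -mulnA in hC; lia.
have prod := leq_mul dU16 dC8.
have bad : (k * (27 * m) ^ 2 <= 3 * (m * #|U|) * (27 * m) ^ 2)%N.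
  by rewrite leq_mul2r ltnW ?orbT.
have small : (100 * (m ^ 2 * #|U| * m) <= m ^ 2 * #|U| * n)%N.
  by rewrite mulnCA leq_mul2l mn orbT.
move: (dU * dC)%N hp prod => d hp prod.
have e1 : (16 * (m * #|U|) * (8 * (m * n)) = 128 * (m ^ 2 * #|U| * n))%N.
  by rewrite -mulnn; ring.
have e2 : (3 * (m * #|U|) * (27 * m) ^ 2 = 2187 * (m ^ 2 * #|U| * m))%N.
  by rewrite -!mulnn; ring.
move: prod bad hp small; rewrite e1 e2.
move: (m ^ 2 * #|U| * n)%N (m ^ 2 * #|U| * m)%N (k * _)%N; lia.
Qed.

Lemma crossing_step (R : realType) (beta : R) (n E m j : nat) (U : {set 'I_n}) :
  (0 < m)%N -> (100 * m <= n)%N -> (2 * #|U| <= n)%N -> (0 < #|U|)%N ->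
  (j < m * #|U|)%N ->
  \sum_(G in sparse_cut E m U (m * #|U| + 2 * j)) gibbs_weight beta G <=
    #|U|%:R / (4 * n)%:R *
    \sum_(G in sparse_cut E m U (m * #|U| + 2 * j.+1)) gibbs_weight beta G.
Proof.
move=> m0 mn Un U0 jm; have n0 : (0 < n)%N by lia.
(* Even after the switching the cut has at most 3m|U| edges, as j < m|U|. This serves both the
   forward count and the reverse count. *)
have cut3 k : (k < m * #|U| + 2 * j -> k + 2 <= 3 * (m * #|U|))%N.
  by move: jm; move: (m * _)%N; lia.
have inS G k : G \in sparse_cut E m U k ->
    [/\ G \in simple_graphs n E, [forall i, (19 * m <= deg G i <= 27 * m)%N] &
        (edge_cut G U < k)%N].
  by rewrite inE => /andP[]; rewrite inE => /andP[].
apply: (switching_bound (P := fun G => inner_pairs G U)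
  (Q := fun G => outer_pairs G U) (f := @cross n)).
- by move=> G; exact: gibbs_weight_ge0.
- by rewrite divr_ge0.
- move=> G t /inS[sG bG cG] tP; have [sf df cf tQ] := cross_facts sG tP.
  split=> //; rewrite inE cf inE sf /=; apply/andP; split; last first.
    by rewrite mulnS [(2 + _)%N]addnC addnA ltn_add2r.
  by apply/forallP => i; rewrite df; exact: (forallP bG).
- move=> t G H _ _ tG tH fGH.
  by rewrite -(crossK tG) fGH (crossK tH).
- move=> G GS; have [sG bG cG] := inS _ _ GS.
  apply: (@leq_trans (36 * (m ^ 2 * #|U| * n))); first by rewrite !muln_gt0 m0 U0 n0.
  apply: (@inner_pairs_ge _ E) => //; rewrite 2!inE sG bG /=.
  by apply: leq_trans (cut3 _ cG); rewrite addn2 ltnS leqW.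
- move=> G t GS tP; have [sG bG cG] := inS _ _ GS.
  have [sf df cf _] := cross_facts sG tP.
  have -> : gibbs_weight beta (cross t G) = gibbs_weight beta G.
    by rewrite /gibbs_weight; under eq_bigr do rewrite df.
  have le : (36 * (m ^ 2 * #|U| * n) <= #|inner_pairs G U|)%N.
    apply: (@inner_pairs_ge _ E) => //; rewrite 2!inE sG bG /=.
    by apply: leq_trans (cut3 _ cG); rewrite addn2 ltnS leqW.
  rewrite [_ / _ * _]mulrC -!mulrA ler_wpM2l ?gibbs_weight_ge0 //.
  rewrite mulrA mulrC mulrA ler_pdivlMr ?ltr0n ?muln_gt0 ?n0 //.
  rewrite -!natrM ler_nat card_outer_pairs cf.
  (* The ratio of (3mu)^2 reverse to 36 m^2 un forward choices is exactly u / (4n). *)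
  have := leq_mul (cut3 _ cG) (cut3 _ cG); rewrite mulnn => sq.
  apply: leq_trans (leq_mul sq (leqnn _)) _.
  apply: leq_trans (leq_mul le (leqnn _)).
  by rewrite -!mulnn; lia.
Qed.

Lemma sparse_cut_bound (R : realType) (beta : R) (n E m : nat) (U : {set 'I_n}) :
  (0 < m)%N -> (100 * m <= n)%N -> (2 * #|U| <= n)%N -> (0 < #|U|)%N ->
  \sum_(G in sparse_cut E m U (m * #|U|)) gibbs_weight beta G <=
    (#|U|%:R / (4 * n)%:R) ^+ (m * #|U|) * partition_function beta n E.
Proof.
move=> m0 mn Un U0.
pose u k := \sum_(G in sparse_cut E m U (m * #|U| + 2 * k)) gibbs_weight beta G.
have a0 : 0 <= #|U|%:R / (4 * n)%:R :> R by rewrite divr_ge0.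
have := @geometric_chain _ u _ (m * #|U|) a0
  (fun j jm => crossing_step beta E m0 mn Un U0 jm).
rewrite /u muln0 addn0 => /le_trans; apply.
rewrite ler_wpM2l ?exprn_ge0 // /partition_function.
rewrite [leLHS]big_mkcond [leRHS]big_mkcond /=; apply: ler_sum => G _.
rewrite 2!inE; case: (G \in simple_graphs _ _) => //=.
by case: ifP => // _; exact: gibbs_weight_ge0.
Qed.

(** * Union bounds over pairs of vertices and over vertex sets *)

Lemma union_bound (R : realDomainType) (Om I : finType) (w : Om -> R)
    (A : {set Om}) (P : pred I) (B : I -> {set Om}) :
  (forall G, 0 <= w G) ->
  (forall G, G \in A -> exists2 i, P i & G \in B i) ->
  \sum_(G in A) w G <= \sum_(i | P i) \sum_(G in B i) w G.
Proof.
move=> w0 AB; rewrite (exchange_big_dep predT) //= big_mkcond.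
apply: ler_sum => G _; case: ifP => [/AB[i Pi GB]|_]; last exact: sumr_ge0.
by rewrite (bigD1 i) ?Pi //= lerDl sumr_ge0.
Qed.

(** If all degrees were within 3m of each other, one degree below 19m would force the mean 2E/n to
    at most 22m, and one above 27m would force it beyond 24m. *)
Lemma unbalanced_spread (n m E : nat) (G : graph n) :
  (0 < m)%N -> (22 * m * n < 2 * E <= 24 * m * n)%N ->
  G \in simple_graphs n E -> G \notin balanced n E m ->
  exists2 p : 'I_n * 'I_n, p.2 != p.1 & G \in spread E p.1 p.2 (3 * m).
Proof.
move=> m0 /andP[Elo Ehi] sG nbG.
have [|none] := pselect
  (exists2 p : 'I_n * 'I_n, p.2 != p.1 & G \in spread E p.1 p.2 (3 * m)); first by [].
have close v x : (deg G x < deg G v + 3 * m)%N.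
  have [->|xv] := eqVneq x v; first by rewrite -addn1 leq_add2l muln_gt0.
  rewrite ltnNge; apply/negP => far; apply: none.
  by exists (v, x); rewrite // inE sG.
have sum_le d : (forall i, (deg G i <= d)%N) -> (2 * E <= d * n)%N.
  move=> dG; rewrite -(handshake sG) mulnC.
  have <- : (\sum_(i < n) d = n * d)%N by rewrite sum_nat_const card_ord.
  exact: leq_sum.
have sum_ge d : (forall i, (d <= deg G i)%N) -> (d * n <= 2 * E)%N.
  move=> dG; rewrite -(handshake sG) mulnC.
  have <- : (\sum_(i < n) d = n * d)%N by rewrite sum_nat_const card_ord.
  exact: leq_sum.
case/negP: nbG; rewrite inE sG; apply/forallP => i.
have n0 : (0 < n)%N by case: n i {sG none close sum_le sum_ge Elo Ehi G}; first case.
apply/andP; split; rewrite leqNgt; apply/negP => di.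
  suff /sum_le : forall j, (deg G j <= 22 * m)%N by rewrite leqNgt Elo.
  by move=> j; have := close i j; lia.
suff /sum_ge : forall j, (24 * m + 1 <= deg G j)%N by nia.
by move=> j; have := close j i; lia.
Qed.

(** The number u^u / u! is a single term of the series of e^u, while 'C(n, u) u! is a falling
    factorial, at most n^u. *)
Lemma bin_mul_exp_le (R : realType) (n u : nat) : (0 < n)%N ->
  'C(n, u)%:R * (u%:R / n%:R) ^+ u <= expR 1 ^+ u :> R.
Proof.
move=> n0; case: u => [|u]; first by rewrite bin0 !expr0 mul1r.
have n0' : 0 < n%:R :> R by rewrite ltr0n.
rewrite expr_div_n mulrA ler_pdivrMr ?exprn_gt0 //.
have e_ge : u.+1%:R ^+ u.+1 / u.+1`!%:R <= expR 1 ^+ u.+1 :> R.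
  rewrite -expRM_natl mulr1.
  by apply: le_trans (expR_ge1Dxn u (ler0n R u.+1)); rewrite lerDr.
have f0 : 0 < u.+1`!%:R :> R by rewrite ltr0n fact_gt0.
rewrite ler_pdivrMr // in e_ge.
have c_le : 'C(n, u.+1)%:R * u.+1`!%:R <= n%:R ^+ u.+1 :> R.
  rewrite -natrM bin_ffact -natrX ler_nat.
  by elim: u.+1 => // k IH; rewrite ffactnSr expnSr leq_mul ?leq_subr.
apply: le_trans (ler_wpM2l (ler0n _ _) e_ge) _.
by rewrite mulrCA ler_wpM2l ?exprn_ge0 ?expR_ge0.
Qed.

Lemma sum_by_card (R : realType) (n : nat) (g : nat -> R) :
  \sum_(U : {set 'I_n}) g #|U| = \sum_(k < n.+1) 'C(n, k)%:R * g k.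
Proof.
rewrite (partition_big (fun U : {set 'I_n} => inord #|U| : 'I_n.+1) predT) //=.
apply: eq_bigr => k _.
have cardE (U : {set 'I_n}) : (inord #|U| == k :> 'I_n.+1) = (#|U| == k).
  rewrite -val_eqE /= inordK // ltnS -[X in (_ <= X)%N]card_ord.
  exact: max_card.
rewrite (eq_bigl _ _ cardE) (eq_bigr (fun=> g k)) => [|U /eqP-> //].
have -> : 'C(n, k) = #|[set U : {set 'I_n} | #|U| == k]|.
  by rewrite card_draws card_ord.
by rewrite sumr_const -[LHS]mulr_natl; congr (_%:R * _); apply: eq_card => U; rewrite !inE.
Qed.

Lemma geometric_sum_le2 (R : realFieldType) (r : R) (n : nat) :
  0 <= r -> r <= 2^-1 -> \sum_(k < n) r ^+ k <= 2.
Proof.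
(* Carrying the tail bound 2 r^n makes the induction go through. *)
move=> r0 r2; suff : \sum_(k < n) r ^+ k + 2 * r ^+ n <= 2.
  by apply: le_trans; rewrite lerDl mulr_ge0 ?exprn_ge0.
elim: n => [|n]; first by rewrite big_ord0 expr0 add0r mulr1.
rewrite big_ord_recr /= exprS; have := exprn_ge0 n r0.
by move: (\sum_(_ < _) _) (r ^+ n) => S t; nra.
Qed.

Lemma small_set_sum (R : realType) (n m : nat) : (0 < n)%N -> (0 < m)%N ->
  expR 1 * 4^-1 ^+ m <= 2^-1 :> R ->
  \sum_(U : {set 'I_n} | (0 < #|U|)%N)
      (#|U|%:R / (4 * n)%:R) ^+ (m * #|U|) <= 2 * (expR 1 * 4^-1 ^+ m) :> R.
Proof.
move=> n0 m0; set r : R := _ * _ => r2.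
have r0 : 0 <= r by rewrite mulr_ge0 ?expR_ge0 ?exprn_ge0.
(* The value at 0 is set to 0 to leave out the empty set, whose power would be 1. *)
pose g k : R := if (0 < k)%N then (k%:R / (4 * n)%:R) ^+ (m * k) else 0.
rewrite big_mkcond (sum_by_card n g).
rewrite big_ord_recl mulr0 add0r.
apply: (@le_trans _ _ (\sum_(k < n) r * r ^+ k)); last first.
  by rewrite -mulr_sumr mulrC ler_wpM2r // geometric_sum_le2.
apply: ler_sum => k _; rewrite -exprS {}/g /= /bump leq0n add1n.
set u := k.+1; have un : (u <= n)%N := ltn_ord k.
have n0' : 0 < n%:R :> R by rewrite ltr0n.
have q0 : 0 <= u%:R / n%:R :> R by rewrite divr_ge0.
have q1 : u%:R / n%:R <= 1 :> R by rewrite ler_pdivrMr // mul1r ler_nat.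
have h0 : 0 <= 4^-1 ^+ m :> R by rewrite exprn_ge0.
(* Of the m factors u/n one is kept, to be paired with the binomial coefficient; the others are at
   most 1. *)
have term : (u%:R / (4 * n)%:R) ^+ m <= u%:R / n%:R * 4^-1 ^+ m :> R.
  rewrite natrM invfM mulrCA mulrC exprMn ler_wpM2r // -(prednK m0) exprS.
  by rewrite ler_piMr // exprn_ile1.
rewrite exprM; apply: (@le_trans _ _ ('C(n, u)%:R * (u%:R / n%:R * 4^-1 ^+ m) ^+ u)).
  by rewrite ler_wpM2l // lerXn2r ?nnegrE ?mulr_ge0 ?exprn_ge0 ?divr_ge0.
rewrite [in leLHS]exprMn mulrA /r [in leRHS]exprMn ler_wpM2r ?exprn_ge0 //.
exact: bin_mul_exp_le.
Qed.

(** * Probability of the good graphs *)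

Lemma gibbs_prob_le1 (R : realType) (beta : R) (n E : nat) (A : set (graph n)) :
  gibbs_prob beta E A <= 1.
Proof.
have Z0 : 0 <= partition_function beta n E.
  by apply: sumr_ge0 => G _; exact: gibbs_weight_ge0.
(* A vanishing partition function makes the quotient 0. *)
rewrite /gibbs_prob; have [->|Zneq0] := eqVneq (partition_function beta n E) 0.
  by rewrite invr0 mulr0.
rewrite ler_pdivrMr ?lt_neqAle ?Z0 1?eq_sym ?Zneq0 // mul1r /partition_function.
rewrite [leRHS](bigID (fun G => G \in A)) /= lerDl.
by apply: sumr_ge0 => G _; exact: gibbs_weight_ge0.
Qed.

Lemma partition_function_gt0 (R : realType) (beta : R) (n E : nat) :
  (E <= 'C(n, 2))%N -> 0 < partition_function beta n E.
Proof.
move=> En; pose S := [set e : {set 'I_n} | #|e| == 2%N].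
pose s := take E (enum S); pose G0 : graph n := [set e in s].
have G0simple : G0 \in simple_graphs n E.
  rewrite inE; apply/andP; split.
    by apply/forall_inP => e; rewrite inE => /mem_take; rewrite mem_enum inE.
  rewrite cardsE (card_uniqP _) ?take_uniq ?enum_uniq // size_takel //.
  by rewrite -cardE card_draws card_ord.
rewrite /partition_function (bigD1 G0) //= ltr_wpDr ?expR_gt0 //.
by apply: sumr_ge0 => G _; exact: gibbs_weight_ge0.
Qed.

Lemma gibbs_prob_ge (R : realType) (beta : R) (n m E : nat) (A : set (graph n)) :
  0 <= beta -> (0 < m)%N -> (22 * m * n < 2 * E <= 24 * m * n)%N ->
  (100 * m <= n)%N -> (E <= 'C(n, 2))%N -> expR 1 * 4^-1 ^+ m <= 2^-1 :> R ->
  (forall G, G \in balanced n E m ->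
     (forall U : {set 'I_n}, (2 * #|U| <= n)%N -> (m * #|U| <= edge_cut G U)%N) ->
     A G) ->
  1 - ((n ^ 2)%:R * expR (- (beta * (2 * m)%:R)) ^+ m + 2 * (expR 1 * 4^-1 ^+ m))
    <= gibbs_prob beta E A.
Proof.
move=> b0 m0 Emn mn En r2 goodA.
have n0 : (0 < n)%N by lia.
have Z0 := partition_function_gt0 beta En.
have w0 G := @gibbs_weight_ge0 R beta n G.
rewrite /gibbs_prob ler_pdivlMr // mulrBl mul1r lerBlDr.
rewrite {1}/partition_function (bigID (fun G => G \in A)) /= lerD2l.
(* A graph outside [A] is unbalanced or has a sparse cut. The empty set meets the cut bound
   trivially, so a violating U is nonempty. *)
pose A1 := simple_graphs n E :\: balanced n E m.
pose A2 := [set G in balanced n E m |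
  [exists U : {set 'I_n}, [&& (0 < #|U|)%N, (2 * #|U| <= n)%N &
     (edge_cut G U < m * #|U|)%N]]].
apply: (@le_trans _ _ (\sum_(G in A1) gibbs_weight beta G +
                       \sum_(G in A2) gibbs_weight beta G)).
  rewrite big_mkcond [X in _ <= X + _]big_mkcond [X in _ <= _ + X]big_mkcond /=.
  rewrite -big_split; apply: ler_sum => G _ /=.
  case: ifP => [/andP[sG nA]|_]; last by do 2 case: ifP => _; rewrite ?addr0 ?add0r ?addr_ge0.
  rewrite in_setD sG andbT; case: (boolP (G \in balanced n E m)) => bG /=; last first.
    by rewrite lerDl; case: ifP.
  rewrite add0r in_set bG /=; case: ifP => // /negbT; rewrite negb_exists => /forallP noU.
  case/negP: nA; apply: mem_set; apply: goodA => // U Un.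
  have := noU U; rewrite Un /=; case: (#|U|) => [|u]; first by rewrite muln0.
  by rewrite -leqNgt.
rewrite mulrDl; apply: lerD.
  have := union_bound (A := A1) (P := fun p : 'I_n * 'I_n => p.2 != p.1)
    (B := fun p => spread E p.1 p.2 (3 * m)) w0.
  move/(_ _)/le_trans; apply.
    by move=> G; rewrite inE => /andP[nbG sG]; exact: unbalanced_spread nbG.
  apply: (@le_trans _ _ (\sum_(p : 'I_n * 'I_n)
      expR (- (beta * (2 * m)%:R)) ^+ m * partition_function beta n E)).
    rewrite big_mkcond; apply: ler_sum => p _; case: ifP => [pP|_].
      exact: spread_bound.
    by rewrite mulr_ge0 ?exprn_ge0 ?expR_ge0 // ltW.
  by rewrite sumr_const card_prod card_ord mulnn -[leLHS]mulr_natl mulrA.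
have := union_bound (A := A2)
  (P := fun U : {set 'I_n} => (0 < #|U|)%N && (2 * #|U| <= n)%N)
  (B := fun U => sparse_cut E m U (m * #|U|)) w0.
move/(_ _)/le_trans; apply.
  move=> G; rewrite inE => /andP[bG /existsP[U /and3P[U0 Un cU]]].
  by exists U; rewrite ?U0 // inE bG.
apply: le_trans (ler_wpM2r (ltW Z0) (small_set_sum n0 m0 r2)).
rewrite mulr_suml [leLHS]big_mkcond [leRHS]big_mkcond; apply: ler_sum => U _ /=.
have p0 : 0 <= (#|U|%:R / (4 * n)%:R) ^+ (m * #|U|) * partition_function beta n E.
  by rewrite mulr_ge0 ?exprn_ge0 ?divr_ge0 // ltW.
case: ifP => [/andP[U0 Un]|_]; last by case: ifP.
by rewrite U0 sparse_cut_bound.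
Qed.

(** * Expansion and conductance of good graphs *)

Lemma exists_deg_le_mean (n E : nat) (G : graph n) :
  (0 < n)%N -> G \in simple_graphs n E -> exists i, (n * deg G i <= 2 * E)%N.
Proof.
move=> n0 sG; case: (@arg_minnP _ (Ordinal n0) predT (deg G) isT) => i _ imin.
exists i; rewrite -(handshake sG) -[X in (X * _)%N]card_ord -sum_nat_const.
by apply: leq_sum => j _; exact: imin.
Qed.

(** Small volume does not mean few vertices. If U has more than n/2 vertices, its complement is
    small, has the same cut, and has at least the volume of U because the volumes add up to 2E. *)
Lemma vol_le_edge_cut (n m E : nat) (G : graph n) (U : {set 'I_n}) :
  G \in balanced n E m ->
  (forall W : {set 'I_n}, (2 * #|W| <= n)%N -> (m * #|W| <= edge_cut G W)%N) ->
  (vol G U <= #|G|)%N -> (vol G U <= 27 * edge_cut G U)%N.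
Proof.
rewrite inE => /andP[sG /forallP dG] cutG; rewrite (simple_card sG) => volU.
have vol_small (W : {set 'I_n}) : (2 * #|W| <= n)%N -> (vol G W <= 27 * edge_cut G W)%N.
  move=> Wn; apply: (@leq_trans (27 * (m * #|W|))); last by rewrite leq_mul2l cutG.
  rewrite mulnA mulnC -sum_nat_const; apply: leq_sum => i _.
  by have /andP[] := dG i.
have [/vol_small//|Ubig] := leqP (2 * #|U|) n.
have Uc : (2 * #|~: U| <= n)%N.
  by have := cardsC U; rewrite card_ord; move: Ubig; move: #|U| #|~: U|; lia.
have := vol_small _ Uc; rewrite edge_cutC; apply: leq_trans.
have := vol_setC U sG; move: volU; move: (vol G U) (vol G (~: U)); lia.
Qed.

Lemma balanced_expander (R : realType) (c L : R) (n m E : nat) (G : graph n) :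
  (0 < m)%N -> (1 < n)%N -> c * L <= (27 * m)%:R -> (2 * E)%:R <= c * n%:R * L ->
  G \in balanced n E m ->
  (forall U : {set 'I_n}, (2 * #|U| <= n)%N -> (m * #|U| <= edge_cut G U)%N) ->
  (forall U : {set 'I_n}, (2 * #|U| <= n)%N ->
     27^-1 * c * #|U|%:R * L <= (edge_cut G U)%:R) /\
  (27^-1 * c * L <= expansion R G /\ expansion R G <= c * L) /\
  (27^-1 <= conductance R G /\ conductance R G <= 1).
Proof.
move=> m0 n1 cL Ec bG cutG; have n0 : (0 < n)%N by apply: ltnW.
have [sG dG] : G \in simple_graphs n E /\ forall i, (19 * m <= deg G i <= 27 * m)%N.
  by move: bG; rewrite inE => /andP[? /forallP ?].
have cut_ge (U : {set 'I_n}) : (2 * #|U| <= n)%N ->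
    27^-1 * c * L * #|U|%:R <= (edge_cut G U)%:R.
  move=> /cutG; rewrite -(ler_nat R); apply: le_trans.
  rewrite natrM ler_wpM2r // -mulrA ler_pdivrMl //.
  by rewrite -natrM.
have one_small (i : 'I_n) : [set i] != set0 /\ (2 * #|[set i]| <= n)%N.
  by rewrite cards1; split => //; apply/set0Pn; exists i; rewrite inE.
pose i0 := Ordinal n0.
split; first by move=> U Un; rewrite mulrAC; exact: cut_ge.
split; split.
(* A lower bound passes to the infimum only over a nonempty index set; a singleton provides the
   element. *)
- apply: lb_le_inf.
    by exists ((edge_cut G [set i0])%:R / #|[set i0]|%:R); exists [set i0].
  move=> _ [U [U0 Un] <-]; rewrite ler_pdivlMr ?cut_ge //.
  by rewrite ltr0n card_gt0.
(* A single vertex of at most mean degree witnesses the upper bound. *)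
- have [i di] := exists_deg_le_mean n0 sG.
  apply: (@le_trans _ _ ((edge_cut G [set i])%:R / #|[set i]|%:R)).
    apply: ge_inf; last by exists [set i].
    by exists 0 => _ [U _ <-]; rewrite divr_ge0.
  rewrite cards1 divr1 (edge_cut1 _ sG) -(@ler_pM2l _ n%:R) ?ltr0n //.
  rewrite -natrM (le_trans _ (le_trans Ec _)) ?ler_nat //.
  by rewrite mulrCA mulrA.
- apply: lb_le_inf; last first.
    move=> _ [U /andP[U0 Un] <-]; rewrite ler_pdivlMr ?ltr0n //.
    by rewrite ler_pdivrMl // -natrM ler_nat (vol_le_edge_cut bG).
  exists ((edge_cut G [set i0])%:R / (vol G [set i0])%:R); exists [set i0] => //.
  rewrite /= /vol big_set1; apply/andP; split.
    by have /andP[+ _] := dG i0; apply: leq_trans; rewrite muln_gt0.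
  by apply/subset_leq_card/subsetP => e; rewrite inE => /andP[].
(* All edges at a single vertex leave it, so its ratio is exactly 1. *)
- apply: (@le_trans _ _ ((edge_cut G [set i0])%:R / (vol G [set i0])%:R)).
    apply: ge_inf; first by exists 0 => _ [U _ <-]; rewrite divr_ge0.
    exists [set i0] => //.
    rewrite /= /vol big_set1; apply/andP; split.
      by have /andP[+ _] := dG i0; apply: leq_trans; rewrite muln_gt0.
    by apply/subset_leq_card/subsetP => e; rewrite inE => /andP[].
  rewrite (edge_cut1 _ sG) /vol big_set1 divff // pnatr_eq0 -lt0n.
  by have /andP[+ _] := dG i0; apply: leq_trans; rewrite muln_gt0.
Qed.

(** * Asymptotics of the scale and the limit *)

Local Open Scope classical_set_scope.
Local Open Scope ring_scope.

Lemma ln_nat_large (R : realType) (M : R) :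
  \forall n \near \oo, M <= ln (n%:R : R).
Proof.
near=> n; have : expR M <= n%:R by near: n; exact: nbhs_infty_ger.
move=> le; rewrite -(expRK M) ler_ln ?posrE ?expR_gt0 //.
exact: lt_le_trans (expR_gt0 M) le.
Unshelve. all: by end_near. Qed.

(* The unit in which degrees are measured: c ln n lies between 23 m and 23 (m + 1),
   so that a degree spread below 3 m leaves all degrees in [19 m, 27 m]. *)
Definition scale (R : realType) (c : R) (n : nat) : nat :=
  Num.truncn (c * ln n%:R / 23).

Lemma scale_large (R : realType) (c : R) : 0 < c -> scale c n @[n --> \oo] --> \oo.
Proof.
move=> c0; apply/cvgnyPge => M; near=> n.
have large : M%:R * 23 / c <= ln (n%:R : R) by near: n; exact: ln_nat_large.
rewrite ler_pdivrMr // in large.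
have large' : M%:R <= c * ln n%:R / 23 :> R by rewrite ler_pdivlMr // [c * _]mulrC.
by rewrite /scale truncn_ge_nat // (le_trans _ large').
Unshelve. all: by end_near. Qed.

Lemma scale_bounds (R : realType) (beta c : R) : 0 < beta -> 0 < c ->
  \forall n \near \oo, let m := scale c n in let E := num_edges c n in
  [/\ (23 <= m)%N, (1 < n)%N, (100 * m <= n)%N, (E <= 'C(n, 2))%N &
   [/\ (22 * m * n < 2 * E <= 24 * m * n)%N,
   c * ln n%:R <= (27 * m)%:R, (2 * E)%:R <= c * n%:R * ln n%:R &
   (n ^ 2)%:R * expR (- (beta * (2 * m)%:R)) ^+ m <= expR (-1) ^+ m]].
Proof.
move=> b0 c0; near=> n.
(* This absorbs the rounding of m: cL < 23(m + 1) <= 24m. *)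
have m23 : (23 <= scale c n)%N.
  by near: n; have /cvgnyPge := scale_large c0; apply.
have n1 : (1 < n)%N by near: n; exact: nbhs_infty_gt.
have L0 : 0 <= ln n%:R :> R by near: n; exact: ln_nat_large.
(* [L1] gives 100m <= 100cL/23 <= L^2/2 <= n, and [L2] gives cL <= L^2/2 <= n - 1, hence 2E <= n(n -
   1). *)
have L1 : 200 * c / 23 <= ln n%:R :> R by near: n; exact: ln_nat_large.
have L2 : 2 * c <= ln n%:R :> R by near: n; exact: ln_nat_large.
(* As L <= 46m/c, this size of m yields 2 beta m^2 >= 2L + m, so that n^2 e^(-2 beta m^2) <=
   e^(-m). *)
have bm : (92 / c + 1) / (2 * beta) <= (scale c n)%:R.
  near: n; exact: (scale_large c0 (nbhs_infty_ger ((92 / c + 1) / (2 * beta)))).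
move: m23 L0 L1 L2 bm; set L : R := ln n%:R; set m := scale c n => m23 L0 L1 L2 bm.
set E := num_edges c n.
have n0 : 0 < n%:R :> R by rewrite ltr0n ltnW.
have nL : n%:R = expR L by rewrite lnK.
(* n = e^L >= L^2 / 2 dominates every multiple of L. *)
have nge : 1 + L ^+ 2 / 2 <= n%:R.
  by rewrite nL; have := expR_ge1Dxn 1 L0; rewrite /= factE.
have cL0 : 0 <= c * L by rewrite mulr_ge0 // ltW.
have /andP[mlo mhi] : m%:R <= c * L / 23 < m.+1%:R.
  by apply: truncn_itv; rewrite divr_ge0.
have /andP[Elo Ehi] : E%:R <= c * n%:R * L / 2 < E.+1%:R.
  by apply: truncn_itv; rewrite divr_ge0 // mulrAC mulr_ge0.
rewrite -[m.+1%:R]natr1 in mhi; rewrite -[E.+1%:R]natr1 in Ehi.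
have m23' : 23 <= m%:R :> R by rewrite ler_nat.
have n2 : 2 <= n%:R :> R by rewrite ler_nat.
have cnL : c * n%:R * L = c * L * n%:R by rewrite mulrAC.
rewrite cnL in Elo Ehi.
have E2 : 2 * E%:R <= c * L * n%:R by lra.
have E2' : c * L * n%:R < 2 * E%:R + 2 by lra.
have mn : m%:R * n%:R * 23 <= c * L * n%:R.
  by rewrite mulrAC ler_wpM2r // -ler_pdivlMr.
have mn' : c * L * n%:R <= (23 * m%:R + 23) * n%:R.
  by rewrite ler_wpM2r //; lra.
have mn2 : 23 * 2 <= m%:R * n%:R :> R by apply: ler_pM.
split=> //.
- rewrite -(ler_nat R) natrM; apply: le_trans nge.
  by have := ler_wpM2r L0 L1; rewrite -expr2 => h; lra.
- have : (2 * E <= n * n.-1)%N.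
    rewrite -(ler_nat R) !natrM; apply: le_trans E2 _.
    rewrite mulrC ler_wpM2l // -subn1 natrB ?(ltnW n1) //.
    by have := ler_wpM2r L0 L2; rewrite -expr2 => h; lra.
  by rewrite bin2 geq_half_double -mul2n.
split.
(* Rounding E costs less than 2, so 2E > 23mn - 2 > 22mn. *)
- rewrite -(ltr_nat R) -(ler_nat R) !natrM; apply/andP; split; nra.
- by rewrite natrM; lra.
- by rewrite natrM cnL.
rewrite natrX nL -!expRM_natl -expRD ler_expR mulrN1 mulrN.
have m0 : 0 < m%:R :> R by lra.
have Lm : L <= 46 * m%:R / c by rewrite ler_pdivlMr // mulrC; lra.
rewrite ler_pdivrMr ?mulr_gt0 // in bm.
have := ler_wpM2l (ltW m0) bm.
rewrite natrM mulrDr mulr1 => h.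
have -> : m%:R * (beta * (2 * m%:R)) = m%:R * (m%:R * (2 * beta)) by ring.
have e : m%:R * (92 / c) = 2 * (46 * m%:R / c) by ring.
by rewrite e in h; lra.
Unshelve. all: by end_near. Qed.

Theorem theorem5 (R : realType) (beta c : R) (hbeta : 0 < beta) (hc : 0 < c) :
  exists delta : R, (0 < delta /\ delta < 1) /\
    (fun n : nat => gibbs_prob beta (num_edges c n)
       [set G : graph n |
          (forall U : {set 'I_n}, (2 * #|U| <= n)%N ->
             (1 - delta) * c * #|U|%:R * ln n%:R <= (edge_cut G U)%:R) /\
          ((1 - delta) * c * ln n%:R <= expansion R G /\
             expansion R G <= c * ln n%:R) /\
          (1 - delta <= conductance R G /\ conductance R G <= 1)])
      @ \oo --> (1 : R).
Proof.
(* Degrees are at most 27m and cuts have at least m|U| edges, whence the fraction 1/27. *)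
exists (1 - 27^-1); split; first by lra.
rewrite opprB addrC subrK.
(* The two terms bound the unbalanced graphs, with the n^2 pairs already absorbed, and the sparse
   cuts. *)
pose err (m : nat) : R := expR (-1) ^+ m + 2 * (expR 1 * 4^-1 ^+ m).
have cvg4 : expR 1 * 4^-1 ^+ m @[m --> \oo] --> (0 : R).
  rewrite -(mulr0 (expR 1)); apply: cvgMr; apply: cvg_expr.
  by rewrite ger0_norm; lra.
have err0 : err (scale c n) @[n --> \oo] --> (0 : R).
  apply: (cvg_comp (scale c) err (scale_large hc)).
  rewrite -(addr0 (0 : R)) -{2}(mulr0 2); apply: cvgD; last exact: cvgMr cvg4.
  by apply: cvg_expr; rewrite ger0_norm ?expR_ge0 // expR_lt1 ltrN10.
have cvg1 : 1 - err (scale c n) @[n --> \oo] --> (1 : R).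
  by rewrite -[X in _ --> X](subr0 (1 : R)); apply: cvgB => //; exact: cvg_cst.
have r2 : \forall n \near \oo, expR 1 * 4^-1 ^+ scale c n <= 2^-1 :> R.
  have := cvg_comp (scale c) _ (scale_large hc) cvg4.
  by move/cvgr_le; apply; rewrite invr_gt0.
refine (squeeze_cvgr _ cvg1 (cvg_cst (1 : R))).
apply: filterS2 (scale_bounds hbeta hc) r2 => n.
move=> [m23 n1 mn En [Emn cL Ec small]] {}r2.
rewrite gibbs_prob_le1 andbT.
have m0 : (0 < scale c n)%N by apply: leq_trans m23.
apply: le_trans (gibbs_prob_ge (ltW hbeta) m0 Emn mn En r2 _); last first.
  by move=> G bG cutG; exact: balanced_expander bG cutG.
by rewrite lerD2l lerN2 lerD2r.
Qed.
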